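(* Let $(u,v)$ satisfy the boundary conditions and the divergence-free condition of the context. Then for $2\le p<\infty$, $$\varepsilon^{1/2}\Big(\iint|v|^pr^{\frac p2-1+\frac{\delta p}2}\,dR\,d\omega\Big)^{1/p}\lesssim\|v\|_B.$$
   Context: $R_0>0$, $\theta_0>0$ (small), $0<\varepsilon\le1$, $\delta\in[0,1]$. $(\omega,R)\in\Omega=(0,\theta_0)\times(R_0,\infty)$; $r=r(R)=R_0+\sqrt\varepsilon(R-R_0)$; $\iint=\int_0^{\theta_0}\int_{R_0}^\infty\cdot\,dR\,d\omega$. Boundary conditions: $u=v=0$ on $\{\omega=0\}$ and on $\{R=R_0\}$; $\varepsilon v_\omega+ru_R=0$ on $\{\omega=\theta_0\}$ (and, for the associated pressure $P$, $Pr=2\varepsilon u_\omega$ there). Divergence-free condition: $\frac1ru_\omega+\frac{\sqrt\varepsilon}rv+v_R=0$, i.e. $u_\omega+\partial_R(rv)=0$. Norm: $\|v\|_B^2=\iint(r^\delta|\partial_R(rv)|^2+\varepsilon v_\omega^2r^\delta+\varepsilon v^2r^\delta)$. The implicit constant may depend on $p$ but not on $\varepsilon$ or $v$. *)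

(* Defs.v *)
From HB Require Import structures.
From mathcomp Require Import all_boot all_order all_algebra.
From mathcomp Require Import all_classical all_reals all_analysis.

Set Implicit Arguments.
Unset Strict Implicit.
Unset Printing Implicit Defensive.

Import Order.TTheory GRing.Theory Num.Theory.
Import numFieldNormedType.Exports.

Local Open Scope classical_set_scope.
Local Open Scope ring_scope.

(* Functions on the sector are curried: [f w s] is the value at the angle
   [w = omega] and the stretched radius [s = R].  The name [R] is kept for
   the type of real numbers. *)

Definition dw (R : realType) (f : R -> R -> R) : R -> R -> R :=
  fun w s => derive1 (fun x => f x s) w.

Definition ds (R : realType) (f : R -> R -> R) : R -> R -> R :=
  fun w s => derive1 (f w) s.

Definition polar_radius (R : realType) (R0 eps s : R) : R :=
  R0 + Num.sqrt eps * (s - R0).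

Definition sector (R : realType) (R0 theta0 : R) : set (R * R) :=
  [set z | 0 < z.1 < theta0 /\ R0 < z.2].

(* Regularity is required in the open domain only. *)
Definition C1_on (R : realType) (D : set (R * R)) (f : R -> R -> R) : Prop :=
  forall z : R * R, D z ->
    [/\ derivable (fun x => f x z.2) z.1 1,
        derivable (f z.1) z.2 1,
        {for z, continuous (fun y : R * R => dw f y.1 y.2)} &
        {for z, continuous (fun y : R * R => ds f y.1 y.2)}].

(* Boundary values are taken as one-sided limits along the normal direction,
   at the points of each side other than its corners.  For functions that are
   continuous (resp. C^1) up to the boundary these are the usual boundary
   values (resp. boundary values of the derivatives). *)
Definition no_slip (R : realType) (R0 theta0 : R) (f : R -> R -> R) : Prop :=
  (forall s, R0 < s -> f w s @[w --> 0^'+] --> (0 : R)) /\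
  (forall w, 0 < w < theta0 -> f w s @[s --> R0^'+] --> (0 : R)).

Definition boundary_conditions (R : realType) (R0 theta0 eps : R)
    (u v P : R -> R -> R) : Prop :=
  [/\ no_slip R0 theta0 u,
      no_slip R0 theta0 v,
      forall s, R0 < s ->
        eps * dw v w s + polar_radius R0 eps s * ds u w s
          @[w --> theta0^'-] --> (0 : R) &
      forall s, R0 < s ->
        P w s * polar_radius R0 eps s - 2 * eps * dw u w s
          @[w --> theta0^'-] --> (0 : R)].

Definition divergence_free (R : realType) (R0 theta0 eps : R)
    (u v : R -> R -> R) : Prop :=
  forall w s, sector R0 theta0 (w, s) ->
    (polar_radius R0 eps s)^-1 * dw u w s
      + Num.sqrt eps / polar_radius R0 eps s * v w s + ds v w s = 0.

Definition iint (R : realType) (R0 theta0 : R) (F : R -> R -> R) : \bar R :=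
  (\int[lebesgue_measure]_(w in `]0%R, theta0[)
     \int[lebesgue_measure]_(s in `]R0, +oo[) (F w s)%:E)%E.

(* Possibly [+oo]. *)
Definition normB (R : realType) (R0 theta0 eps delta : R)
    (v : R -> R -> R) : \bar R :=
  ((iint R0 theta0 (fun w s =>
      let r := polar_radius R0 eps s in
      (r `^ delta * `|ds (fun w' s' => polar_radius R0 eps s' * v w' s') w s| ^+ 2
       + eps * (dw v w s) ^+ 2 * r `^ delta
       + eps * (v w s) ^+ 2 * r `^ delta)%R)) `^ 2^-1)%E.

(* Main.v *)
Require Import Defs.
From HB Require Import structures.
From mathcomp Require Import all_boot all_order all_algebra.
From mathcomp Require Import all_classical all_reals all_analysis.
From mathcomp Require Import measurable_realfun.
From mathcomp Require Import ring lra.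

Set Implicit Arguments.
Unset Strict Implicit.
Unset Printing Implicit Defensive.

Import Order.TTheory GRing.Theory Num.Theory.
Import numFieldNormedType.Exports.

Local Open Scope classical_set_scope.
Local Open Scope ring_scope.

(* Put f = r^((1+delta)/2) v.  Then |v|^p r^(p/2-1+delta p/2) = |f|^p / r, while
   normB controls the integrals of f^2/r, f_w^2/r and r f_s^2, i.e. the H^1 norm
   of f in the variables (omega, log r).  After scaling f so that these three
   integrals are at most 1, the moments of even order are bounded inductively:
   since f vanishes on the two sides omega = 0 and R = R0,
     |f|^n / r <= \int n |f|^(n-1) |f_w| / r d omega,
     |f|^n <= \int n |f|^(n-1) |f_s| dR,
   and multiplying the two and integrating (Tonelli, as in the Loomis-Whitney
   inequality) bounds the integral of f^(2n)/r by that of f^(2n-2)/r.  Real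
   exponents follow from |x|^p <= x^2 + x^(2n) for 2 <= p <= 2n. *)

(** * Measurability of open sets and of continuous functions in the plane *)

(** Every point of [O] lies in a box with rational end points contained in [O]. Hence [O] is a
    countable union of rectangles, which are measurable for the product sigma-algebra. *)
Lemma open_measurable_prod (R : realType) (O : set (R * R)) :
  open O -> measurable O.
Proof.
move=> oO.
pose box (q : (rat * rat) * (rat * rat)) : set (R * R) :=
  `](ratr q.1.1 : R), ratr q.1.2[ `*` `](ratr q.2.1 : R), ratr q.2.2[.
(* Boxes that leave [O] are replaced by the empty set, so that the union runs over a whole countable
   type. *)
pose F q := if `[< box q `<=` O >] then box q else set0.
have -> : O = \bigcup_q F q.
  apply/seteqP; split=> [z Oz|z [q _]]; last first.
    by rewrite /F; case: asboolP => // + qz => /(_ _ qz).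
  have /nbhs_ballP[e /= e0 zeO] : nbhs z O by rewrite nbhsE /=; exists O.
  have ex (x : R) : exists q : rat * rat,
      ratr q.1 < x < ratr q.2 /\ `](ratr q.1 : R), ratr q.2[ `<=` ball x e.
    have [a] := @rat_in_itvoo R (x - e) x ltac:(by rewrite ltrBlDr ltrDl).
    have [b] := @rat_in_itvoo R x (x + e) ltac:(by rewrite ltrDl).
    rewrite !in_itv /= => /andP[xb bxe] /andP[xea ax].
    exists (a, b); split; first by rewrite /= ax.
    move=> y /=; rewrite in_itv /= => /andP[ay yb].
    by rewrite /ball /= ltr_distlC; apply/andP; split;
      [exact: lt_trans ay|exact: lt_trans bxe].
  have [q1 [z1 q1e]] := ex z.1; have [q2 [z2 q2e]] := ex z.2.
  exists (q1, q2) => //; rewrite /F; case: asboolP.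
    by move=> _; split; rewrite /= in_itv.
  by case=> y [/= y1 y2]; apply: zeO; split; [exact: q1e|exact: q2e].
apply: countable_bigcupT_measurable; first exact: countableP.
move=> q; rewrite /F; case: asboolP => // _.
exact: measurableX.
Qed.

Lemma open_continuous_measurable_prod (R : realType) (D : set (R * R))
    (g : R * R -> R) :
  open D -> (forall z, D z -> {for z, continuous g}) -> measurable_fun D g.
Proof.
move=> oD cg; apply: (measurability _ (RGenOpens.measurableE R)).
move=> _ [_ [a [b ->] <-]]; apply: open_measurable_prod.
rewrite openE => z [Dz gz]; apply: filterI; first exact: open_nbhs_nbhs.
apply: (cg z Dz); apply: open_nbhs_nbhs; split => //; exact: interval_open.
Qed.

(** * Control of a function by the integral of its derivative *)

(** Only the right limit of [g] at [a] is known, so the fundamental theorem of calculus is applied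
    on [[y, b]] with [y] so close to [a] that [|g y| < e], for arbitrary [e > 0]. The interval [I]
    is left general to cover both []0, theta0[] and []R0, +oo[]. *)
Lemma normr_le_integral_derive (R : realType) (g dg : R -> R) (I : interval R)
    (a b : R) :
  a < b ->
  (forall y, a < y <= b -> y \in I) ->
  (forall y, y \in I -> is_derive y 1 g (dg y)) ->
  (forall y, y \in I -> {for y, continuous dg}) ->
  g y @[y --> a^'+] --> (0 : R) ->
  (`|g b|%:E <= \int[lebesgue_measure]_(y in [set` I]) `|dg y|%:E)%E.
Proof.
move=> ab abI gdg cdg g0.
have mdg : measurable_fun [set` I] dg.
  apply: subspace_continuous_measurable_fun; first exact: measurable_itv.
  by apply: continuous_in_subspaceT => x; rewrite inE /=; exact: cdg.
apply/lee_addgt0Pr => e e0.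
have [y [/andP[ay yb] gye]] : exists y, a < y < b /\ `|g y| < e.
  have := @filter_ex _ (a^'+) _ (fun y => a < y < b /\ `|g y| < e).
  apply; near=> y; split.
    by apply/andP; split; near: y; [exact: nbhs_right_gt|exact: nbhs_right_lt].
  near: y; have /cvgrPdist_lt/(_ _ e0) := g0; apply: filterS => y.
  by rewrite sub0r normrN.
have aby x : y <= x -> x <= b -> x \in I.
  by move=> yx xb; apply: abI; rewrite xb (lt_le_trans ay yx).
have gc x : y <= x -> x <= b -> {for x, continuous g}.
  move=> yx xb; apply: differentiable_continuous; apply/derivable1_diffP.
  by have [] := gdg _ (aby _ yx xb).
have cdgw : {within `[y, b], continuous dg}.
  apply: continuous_in_subspaceT => x; rewrite inE /= in_itv /= => /andP[yx xb].
  exact: cdg (aby _ yx xb).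
have FTC : (\int[lebesgue_measure]_(x in `[y, b]) (dg x)%:E = (g b)%:E - (g y)%:E)%E.
  apply: continuous_FTC2 => //.
    split.
    - move=> x; rewrite in_itv /= => /andP[/ltW yx /ltW xb].
      by have [] := gdg _ (aby _ yx xb).
    - by apply: cvg_at_right_filter; apply: gc => //; exact: ltW.
    - by apply: cvg_at_left_filter; apply: gc => //; exact: ltW.
  move=> x; rewrite in_itv /= => /andP[/ltW yx /ltW xb].
  by rewrite derive1E; have [_ ->] := gdg _ (aby _ yx xb).
have yab : `[y, b] `<=` [set` I].
  move=> x /=; rewrite in_itv /= => /andP[yx xb]; exact: aby.
have mdgy : measurable_fun `[y, b] dg.
  by apply: measurable_funS yab mdg; exact: measurable_itv.
have I1 : (`|g b - g y|%:E <= \int[lebesgue_measure]_(x in `[y, b]) `|dg x|%:E)%E.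
  have := le_abse_integral (@lebesgue_measure R) (measurable_itv `[y, b])
    (proj2 (measurable_EFinP _ _) mdgy).
  by rewrite FTC.
have I2 : (\int[lebesgue_measure]_(x in `[y, b]) `|dg x|%:E <=
    \int[lebesgue_measure]_(x in [set` I]) `|dg x|%:E)%E.
  apply: ge0_subset_integral => //.
  by apply/measurable_EFinP; exact: measurableT_comp.
apply: (@le_trans _ _ (`|g b - g y|%:E + e%:E)%E); last first.
  by rewrite leeD2r// (le_trans I1).
rewrite -EFinD lee_fin -{1}(subrK (g y) (g b)).
by rewrite (le_trans (ler_normD _ _))// lerD2l ltW.
Unshelve. all: by end_near. Qed.

(** * Iterated integrals of nonnegative functions over the sector *)

Lemma sectorE (R : realType) (R0 theta0 : R) :
  sector R0 theta0 = `]0, theta0[ `*` `]R0, +oo[.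
Proof.
by apply/seteqP; split=> -[w s]; rewrite /sector /= !in_itv /= andbT.
Qed.

Lemma open_sector (R : realType) (R0 theta0 : R) : open (sector R0 theta0).
Proof.
rewrite sectorE openE => -[w s] [ws1 ws2].
by exists (`]0, theta0[%classic, `]R0, +oo[%classic) => //; split;
  apply: open_nbhs_nbhs; split => //; exact: interval_open.
Qed.

Lemma measurable_sector (R : realType) (R0 theta0 : R) :
  measurable (sector R0 theta0).
Proof. by apply: open_measurable_prod; exact: open_sector. Qed.

Section iterated_integrals.
Context (R : realType) (R0 theta0 : R).
Let mu := @lebesgue_measure R.
Let S := sector R0 theta0.
Implicit Types F X Y : R -> R -> R.

Definition msector F := measurable_fun S (fun z => F z.1 z.2).

(** Extension by zero to the plane: Tonelli's theorem then applies on the full product space, and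
    every slice is integrated over the whole line. *)
Let EF F : R * R -> \bar R := (fun z => (F z.1 z.2)%:E) \_ S.

Let EF_ge0 F : (forall w s, S (w, s) -> 0 <= F w s) -> forall z, (0 <= EF F z)%E.
Proof.
move=> F0 [w s]; rewrite /EF patchE; case: ifPn => //; rewrite inE => Sz.
by rewrite lee_fin F0.
Qed.

Let measurable_EF F : msector F -> measurable_fun setT (EF F).
Proof.
move=> mF; rewrite /EF; apply: (proj1 (measurable_restrictT
  (fun z : R * R => (F z.1 z.2)%:E) (measurable_sector R0 theta0))).
exact/measurable_EFinP.
Qed.

Let mem_S (w s : R) :
  ((w, s) \in S) = (w \in (`]0, theta0[%classic : set R)) &&
                     (s \in (`]R0, +oo[%classic : set R)).
Proof. by rewrite /S sectorE; apply/idP/andP; rewrite !inE; case. Qed.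

Let slice_s F w : w \in (`]0, theta0[%classic : set R) ->
  (\int[mu]_(s in `]R0, +oo[) (F w s)%:E = \int[mu]_s EF F (w, s))%E.
Proof.
move=> w0; rewrite integral_mkcond; apply: eq_integral => s _.
by rewrite /EF !patchE mem_S w0.
Qed.

Let slice_w F s : s \in (`]R0, +oo[%classic : set R) ->
  (\int[mu]_(w in `]0%R, theta0[) (F w s)%:E = \int[mu]_w EF F (w, s))%E.
Proof.
move=> s0; rewrite integral_mkcond; apply: eq_integral => w _.
by rewrite /EF !patchE mem_S s0 andbT.
Qed.

Let iint_EF F : iint R0 theta0 F = (\int[mu]_w \int[mu]_s EF F (w, s))%E.
Proof.
rewrite /iint integral_mkcond; apply: eq_integral => w _.
rewrite patchE; case: ifPn => w0; first by rewrite slice_s.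
rewrite integral0_eq// => s _.
by rewrite /EF patchE mem_S (negbTE w0).
Qed.

(** By Tonelli. Comparison, additivity and scaling can then be taken from the product measure,
    without measurability of inner integrals. *)
Lemma iintE F : msector F -> (forall w s, S (w, s) -> 0 <= F w s) ->
  (iint R0 theta0 F = \int[mu \x mu]_(z in S) (F z.1 z.2)%:E)%E.
Proof.
move=> mF F0; rewrite iint_EF [RHS]integral_mkcond.
exact: esym (fubini_tonelli1 (m1 := mu) (m2 := mu) _ (measurable_EF mF) (EF_ge0 F0)).
Qed.

Lemma eq_iint X Y : (forall w s, S (w, s) -> X w s = Y w s) ->
  iint R0 theta0 X = iint R0 theta0 Y.
Proof.
move=> XY; apply: eq_integral => w w0; apply: eq_integral => s s0.
by rewrite XY //; apply/set_mem; rewrite mem_S w0 s0.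
Qed.

Lemma iint_ge0 F : (forall w s, S (w, s) -> 0 <= F w s) ->
  (0 <= iint R0 theta0 F)%E.
Proof.
move=> F0; rewrite iint_EF; apply: integral_ge0 => w _.
by apply: integral_ge0 => s _; exact: EF_ge0.
Qed.

Lemma le_iint X Y : msector X -> msector Y ->
  (forall w s, S (w, s) -> 0 <= X w s <= Y w s) ->
  (iint R0 theta0 X <= iint R0 theta0 Y)%E.
Proof.
move=> mX mY XY.
have X0 w s : S (w, s) -> 0 <= X w s by move=> /XY/andP[].
have Y0 w s : S (w, s) -> 0 <= Y w s by move=> /XY/andP[]; exact: le_trans.
rewrite !iintE //; apply: ge0_le_integral => //.
- exact: measurable_sector.
- by move=> [w s] Sz; rewrite lee_fin X0.
- exact/measurable_EFinP.
- exact/measurable_EFinP.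
- by move=> [w s] Sz; rewrite lee_fin; have /andP[] := XY _ _ Sz.
Qed.

Lemma iintD X Y : msector X -> msector Y ->
  (forall w s, S (w, s) -> 0 <= X w s) ->
  (forall w s, S (w, s) -> 0 <= Y w s) ->
  (iint R0 theta0 (fun w s => (X w s + Y w s)%R) =
   iint R0 theta0 X + iint R0 theta0 Y)%E.
Proof.
move=> mX mY X0 Y0.
rewrite !iintE //; last 2 first.
- exact: measurable_funD.
- by move=> w s Sz; rewrite addr_ge0 ?X0 ?Y0.
rewrite -ge0_integralD //; first exact: measurable_sector.
- by move=> [w s] Sz; rewrite lee_fin X0.
- exact/measurable_EFinP.
- by move=> [w s] Sz; rewrite lee_fin Y0.
- exact/measurable_EFinP.
Qed.

Lemma iintZ F (c : R) : 0 <= c -> msector F ->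
  (forall w s, S (w, s) -> 0 <= F w s) ->
  (iint R0 theta0 (fun w s => (c * F w s)%R) = c%:E * iint R0 theta0 F)%E.
Proof.
move=> c0 mF F0; rewrite !iintE //; last 2 first.
- exact: measurable_funM.
- by move=> w s Sz; rewrite mulr_ge0 ?F0.
under eq_integral do rewrite EFinM.
rewrite ge0_integralZl //; first exact: measurable_sector.
- exact/measurable_EFinP.
- by move=> [w s] Sz; rewrite lee_fin F0.
Qed.

(** Two-dimensional Loomis-Whitney argument: the first factor depends on [s] only and the second on
    [w] only, so the double integral of their product splits. *)
Lemma iint_le_mul F X Y : msector F -> msector X -> msector Y ->
  (forall w s, S (w, s) -> 0 <= F w s) ->
  (forall w s, S (w, s) -> 0 <= X w s) ->
  (forall w s, S (w, s) -> 0 <= Y w s) ->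
  (forall w s, S (w, s) -> ((F w s)%:E <=
     (\int[mu]_(w' in `]0%R, theta0[) (X w' s)%:E) *
     (\int[mu]_(s' in `]R0, +oo[) (Y w s')%:E))%E) ->
  (iint R0 theta0 F <= iint R0 theta0 X * iint R0 theta0 Y)%E.
Proof.
move=> mF mX mY F0 X0 Y0 FXY; rewrite !iint_EF.
have mEX := measurable_EF mX; have mEY := measurable_EF mY.
have EX0 := EF_ge0 X0; have EY0 := EF_ge0 Y0.
(* The integral of [X] is taken with [w] innermost, so that its inner integral is the factor
   depending on [s]. *)
rewrite (fubini_tonelli (m1 := mu) (m2 := mu) (EF X)) //.
have mA : measurable_fun setT (fun s => \int[mu]_w EF X (w, s))%E.
  exact: (measurable_fun_fubini_tonelli_G (m1 := mu)).
have mB : measurable_fun setT (fun w => \int[mu]_s EF Y (w, s))%E.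
  exact: (measurable_fun_fubini_tonelli_F (m2 := mu)).
have A0 s : (0 <= \int[mu]_w EF X (w, s))%E by exact: integral_ge0.
have B0 w : (0 <= \int[mu]_s EF Y (w, s))%E by exact: integral_ge0.
rewrite -ge0_integralZl //; last exact: integral_ge0.
apply: ge0_le_integral => //.
- by move=> w _; apply: integral_ge0 => s _; exact: EF_ge0.
- exact: (measurable_fun_fubini_tonelli_F (m2 := mu) _ (measurable_EF mF) (EF_ge0 F0)).
- exact: measurable_funeM.
move=> w _; rewrite -ge0_integralZr //.
apply: ge0_le_integral => //.
- by move=> s _; exact: EF_ge0.
- exact: measurableT_comp (measurable_EF mF) (pair1_measurable w).
- by apply: emeasurable_funM.
move=> s _; rewrite {1}/EF patchE; case: ifPn => [|_]; last exact: mule_ge0.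
move=> Sz; have := Sz; rewrite mem_S => /andP[w0 s0].
move: Sz; rewrite inE => Sz.
by rewrite -slice_w // -slice_s // FXY.
Qed.

End iterated_integrals.

(** * Functions of class C^1 in two variables *)

(** Mean value inequality; [Num.min] and [Num.max] allow its use without knowing the order of the
    end points. *)
Lemma normrB_le_derive_bound (R : realType) (f df : R -> R) (a b M : R) :
  (forall x, Num.min a b <= x <= Num.max a b -> is_derive x 1 f (df x)) ->
  (forall x, Num.min a b <= x <= Num.max a b -> `|df x| <= M) ->
  `|f b - f a| <= M * `|b - a|.
Proof.
wlog ab : a b / a <= b.
  move=> H fdf dfM; have [ab|/ltW ba] := leP a b; first exact: H.
  by rewrite distrC (distrC b); apply: H => // x; rewrite minC maxC;
    [exact: fdf|exact: dfM].
rewrite (min_idPl ab) (max_idPr ab) => fdf dfM.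
have [||c cab ->] := @MVT_segment R f df a b ab.
- by move=> x; rewrite in_itv /= => /andP[/ltW ax /ltW xb]; apply: fdf; rewrite ax.
- apply: continuous_in_subspaceT => x; rewrite inE /= in_itv /= => axb.
  apply: differentiable_continuous; apply/derivable1_diffP.
  by have [] := fdf _ axb.
by rewrite normrM ler_wpM2r // dfM // -in_itv.
Qed.

(** The partial derivatives are explicit arguments, so that closed formulas can be supplied for
    products; joint continuity of [f] is recorded along with them. *)
Definition is_C1_on (R : realType) (D : set (R * R)) (f fw fs : R -> R -> R) :=
  forall z, D z ->
    [/\ is_derive z.1 1 (fun x => f x z.2) (fw z.1 z.2),
        is_derive z.2 1 (f z.1) (fs z.1 z.2),
        {for z, continuous (fun y : R * R => f y.1 y.2)},
        {for z, continuous (fun y : R * R => fw y.1 y.2)} &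
        {for z, continuous (fun y : R * R => fs y.1 y.2)}].

(** Joint continuity of [f] has to be derived: [f z.1] is continuous in the second variable because
    it is derivable, and near [z] the bound [M] on [dw f] controls the variation in the first
    variable. *)
Lemma C1_onP (R : realType) (D : set (R * R)) (f : R -> R -> R) :
  open D -> C1_on D f -> is_C1_on D f (dw f) (ds f).
Proof.
move=> oD C1f z Dz; have [fz1 fz2 cw cs] := C1f z Dz; split; [| | |exact: cw|exact: cs].
- by apply: DeriveDef fz1 _; rewrite /dw derive1E.
- by apply: DeriveDef fz2 _; rewrite /ds derive1E.
pose M := `|dw f z.1 z.2| + 1.
have M0 : 0 < M by rewrite ltr_wpDl.
have cz2 : {for z.2, continuous (f z.1)}.
  by move: fz2 => /derivable1_diffP/differentiable_continuous.
have : \forall y \near z, D y /\ `|dw f y.1 y.2| <= M.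
  apply: filterI; first exact: open_nbhs_nbhs.
  have /cvgrPdist_lt/(_ _ ltr01) := cw; apply: filterS => y yz.
  rewrite -(subrK (dw f z.1 z.2) (dw f y.1 y.2)) addrC.
  by rewrite (le_trans (ler_normD _ _))// lerD2l distrC ltW.
move=> /nbhs_ballP[d /= d0 zd]; apply/cvgrPdist_lt => e e0.
have e20 : 0 < e / 2 by rewrite divr_gt0.
have := cz2; move=> /cvgrPdist_lt/(_ _ e20)/nbhs_ballP[d' /= d'0 zd'].
(* [d] keeps [|dw f| <= M], [d'] makes the change in the second variable less than [e / 2], and
   [e / 2 / M] does the same for the first variable. *)
pose r := Num.min (Num.min d d') (e / 2 / M).
have r0 : 0 < r by rewrite !lt_min d0 d'0 divr_gt0.
apply: filterS (nbhsx_ballx z r r0) => y [yz1 yz2].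
have rd : r <= d by rewrite !ge_min lexx.
have rd' : r <= d' by rewrite !ge_min lexx orbT.
have {}yz2' := zd' _ (le_ball rd' yz2).
have yz1M : `|z.1 - y.1| < e / 2 / M.
  by move: yz1; rewrite /ball /= !lt_min => /andP[].
(* Balls of the product are squares, so the horizontal segment from [y] to [(z.1, y.2)] stays in the
   ball. *)
have near_z x : Num.min y.1 z.1 <= x <= Num.max y.1 z.1 -> ball z d (x, y.2).
  move=> xyz; split; last exact: le_ball yz2.
  have := le_ball rd yz1; rewrite /ball /= !ltr_distlC => /andP[zy yz].
  move: xyz; rewrite ge_min le_max => /andP[/orP[|] ? /orP[|] ?]; lra.
rewrite -(subrK (f z.1 y.2) (f z.1 z.2)) -addrA (le_lt_trans (ler_normD _ _))//.
rewrite (splitr e) ltrD//.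
apply: (@le_lt_trans _ _ (M * `|z.1 - y.1|)).
  apply: (normrB_le_derive_bound (f := fun x => f x y.2) (df := fun x => dw f x y.2)).
    move=> x /near_z/zd[Dx _]; have [fx _ _ _] := C1f _ Dx.
    by apply: DeriveDef fx _; rewrite /dw derive1E.
  by move=> x /near_z/zd[].
by rewrite mulrC -ltr_pdivlMr.
Qed.

Lemma continuous_slice1 (R : realType) (h : R -> R -> R) (w s : R) :
  {for (w, s), continuous (fun y : R * R => h y.1 y.2)} ->
  {for w, continuous (fun x => h x s)}.
Proof. by move=> ch; apply: (continuous2_cvg _ ch cvg_id); exact: cvg_cst. Qed.

Lemma continuous_slice2 (R : realType) (h : R -> R -> R) (w s : R) :
  {for (w, s), continuous (fun y : R * R => h y.1 y.2)} ->
  {for s, continuous (h w)}.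
Proof.
move=> ch; apply: (continuous2_cvg (g := fun x : R => x) _ ch); first exact: cvg_cst.
exact: cvg_id.
Qed.

Lemma continuous_comp_snd (R : realType) (g : R -> R) (z : R * R) :
  {for z.2, continuous g} -> {for z, continuous (fun y : R * R => g y.2)}.
Proof.
move=> cg; apply: (@continuous_comp _ _ _ (snd : R * R -> R) g).
  exact: cvg_snd.
exact: cg.
Qed.

Lemma is_derive_continuous (R : realType) (g : R -> R) (x d : R) :
  is_derive x 1 g d -> {for x, continuous g}.
Proof. by case=> /derivable1_diffP/differentiable_continuous. Qed.

Lemma is_derive_affine (R : realType) (b c d x : R) :
  is_derive x 1 (fun y : R => b + c * (y - d)) c.
Proof.
have H := is_deriveD (is_derive_cst b x 1)
  (is_deriveZ c (is_deriveB (is_derive_id x 1) (is_derive_cst d x 1))).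
by move: H; rewrite subr0 add0r /GRing.scale /= mulr1.
Qed.

Lemma is_derive_exprMr (R : realType) (g : R -> R) (n : nat) (c x d : R) :
  is_derive x 1 g d ->
  is_derive x 1 (fun y => g y ^+ n * c) (n%:R * g x ^+ n.-1 * d * c).
Proof.
move=> gd.
have -> : (fun y => g y ^+ n * c) = c *: (g ^+ n).
  by apply/funext => y; rewrite mulrC !fctE.
by apply: is_derive_eq; rewrite /GRing.scale /= mulrC.
Qed.

Lemma cvg_exprM0 (R : realType) (F : set_system R) {FF : Filter F} (g : R -> R)
    (n : nat) (c : R) :
  g x @[x --> F] --> (0 : R) -> g x ^+ n.+1 * c @[x --> F] --> (0 : R).
Proof.
move=> g0; rewrite -[X in _ --> X](mul0r c); apply: cvgM; last exact: cvg_cst.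
have := cvg_comp _ _ g0 (@exprn_continuous R n.+1 0); rewrite expr0n.
by apply.
Qed.

(** * Moments of a function with normalised weighted H^1 energy *)

(** Index [k] stands for the moment of order [2(k+1)]. The square comes from the two factors of the
    Loomis-Whitney product, each at most [j.+2%:R * (moment_bound R j + 1)]. *)
Fixpoint moment_bound (R : realType) (k : nat) : R :=
  if k is j.+1 then (j.+2%:R * (moment_bound R j + 1)) ^+ 2 else 1.

Lemma moment_bound_ge0 (R : realType) (k : nat) : 0 <= moment_bound R k.
Proof. by case: k => [|k] /=; rewrite ?ler01 ?sqr_ge0. Qed.

(** The term [x ^+ 2] dominates when [|x| <= 1], and the term of degree [2n] when [|x| >= 1]. *)
Lemma powR_le_sqr_expr (R : realType) (x p : R) (n : nat) :
  2 <= p <= (n.*2)%:R -> `|x| `^ p <= x ^+ 2 + (x ^+ n) ^+ 2.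
Proof.
move=> /andP[p2 pn]; rewrite -exprM muln2 -(real_normK (num_real x)).
have -> : x ^+ n.*2 = `|x| ^+ n.*2.
  by rewrite -normrX ger0_norm // -muln2 exprM sqr_ge0.
rewrite -!powR_mulrn //.
have [x1|/ltW x1] := leP `|x| 1; last by rewrite ler_wpDl ?powR_ge0 // ler_powR.
have [->|x0] := eqVneq `|x| 0.
  rewrite powR0 ?addr_ge0 ?powR_ge0 // gt_eqF // (lt_le_trans _ p2) //.
by rewrite ler_wpDr ?powR_ge0 // ger_powR // x1 lt_neqAle eq_sym x0 normr_ge0.
Qed.

Section moments.
Context (R : realType) (R0 theta0 : R) (rho : R -> R) (f fw fs : R -> R -> R).
Let S := sector R0 theta0.
Hypothesis rho_gt0 : forall s, R0 < s -> 0 < rho s.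
Hypothesis rho_cont : forall s, R0 < s -> {for s, continuous rho}.
Hypothesis f_C1 : is_C1_on S f fw fs.
Hypothesis f0 : no_slip R0 theta0 f.
Hypothesis f_le1 : (iint R0 theta0 (fun w s => f w s ^+ 2 / rho s)%R <= 1)%E.
Hypothesis fw_le1 : (iint R0 theta0 (fun w s => fw w s ^+ 2 / rho s)%R <= 1)%E.
Hypothesis fs_le1 : (iint R0 theta0 (fun w s => fs w s ^+ 2 * rho s)%R <= 1)%E.

Let contS (g : R -> R -> R) :=
  forall z, S z -> {for z, continuous (fun y : R * R => g y.1 y.2)}.

Let contS_msector g : contS g -> msector R0 theta0 g.
Proof. by move=> cg; apply: open_continuous_measurable_prod => //; exact: open_sector. Qed.

Let cf : contS f. Proof. by move=> z /f_C1[]. Qed.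
Let cfw : contS fw. Proof. by move=> z /f_C1[]. Qed.
Let cfs : contS fs. Proof. by move=> z /f_C1[]. Qed.

Let contM a b : contS a -> contS b -> contS (fun w s => a w s * b w s).
Proof. by move=> ca cb z Sz; apply: cvgM; [exact: ca|exact: cb]. Qed.

Let contX a n : contS a -> contS (fun w s => a w s ^+ n).
Proof.
move=> ca z Sz; apply: (@continuous_comp _ _ _ (fun y : R * R => a y.1 y.2)
  (fun x : R => x ^+ n)); [exact: ca|exact: exprn_continuous].
Qed.

Let contN a : contS a -> contS (fun w s => `|a w s|).
Proof. by move=> ca z Sz; apply: cvg_norm; exact: ca. Qed.

Let contC c : contS (fun _ _ => c).
Proof. by move=> z Sz; exact: cvg_cst. Qed.

Let cont_rho : contS (fun _ s => rho s).
Proof.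
by move=> [w s] [/= _ s0]; apply: continuous_comp_snd; exact: rho_cont.
Qed.

Let cont_rhoV : contS (fun _ s => (rho s)^-1).
Proof.
by move=> [w s] /[dup] [[/= _ s0]] Sz; apply: cvgV; [rewrite gt_eqF ?rho_gt0|exact: cont_rho].
Qed.

(** [dX n] is the [w]-derivative of [f ^+ n / rho], where [rho] is constant in [w], and [dY n] is
    the [s]-derivative of [f ^+ n]. The final factor [1] in [dY] gives both the shape produced by
    [is_derive_exprMr]. *)
Let dX (n : nat) := fun w s => n%:R * f w s ^+ n.-1 * fw w s * (rho s)^-1.
Let dY (n : nat) := fun w s => n%:R * f w s ^+ n.-1 * fs w s * 1.
Let X (n : nat) := fun w s => `|dX n w s|.
Let Y (n : nat) := fun w s => `|dY n w s|.

Let cont_dX n : contS (dX n).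
Proof. by apply: contM => //; do 2 apply: contM => //; exact: contX. Qed.

Let cont_dY n : contS (dY n).
Proof. by apply: contM => //; do 2 apply: contM => //; exact: contX. Qed.

Let cont_X n : contS (X n). Proof. exact/contN/cont_dX. Qed.

Let cont_Y n : contS (Y n). Proof. exact/contN/cont_dY. Qed.

Let normr_mul_le (a b : R) : `|a * b| <= a ^+ 2 + b ^+ 2.
Proof. by rewrite ler_norml; apply/andP; split; nra. Qed.

(** Apply [|a b| <= a^2 + b^2] to [f ^+ n] and [fw] under the common weight [1 / rho]: the first
    square contributes [c], the second at most 1 by [fw_le1]. *)
Let iint_X (c : R) n : (iint R0 theta0 (fun w s => (f w s ^+ n) ^+ 2 / rho s)%R <= c%:E)%E ->
  (iint R0 theta0 (X n.+1) <= (n.+1%:R * (c + 1))%R%:E)%E.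
Proof.
move=> fc.
have sq_ge0 (a w s : R) : S (w, s) -> 0 <= a ^+ 2 / rho s.
  by case=> /= _ s0; rewrite divr_ge0 ?sqr_ge0 ?ltW ?rho_gt0.
have ma a : contS a -> msector R0 theta0 (fun w s => a w s ^+ 2 / rho s).
  by move=> ca; apply: contS_msector; apply: contM => //; exact: contX.
have m1 := ma _ (@contX f n cf); have m2 := ma _ cfw.
apply: (@le_trans _ _ (iint R0 theta0 (fun w s => n.+1%:R *
  ((f w s ^+ n) ^+ 2 / rho s + fw w s ^+ 2 / rho s)))).
  apply: le_iint.
  - by apply: contS_msector; exact: cont_X.
  - by apply: measurable_funM => //; exact: measurable_funD.
  move=> w s [/= _ s0]; rewrite normr_ge0 /=.
  have rV : 0 <= (rho s)^-1 by rewrite invr_ge0 ltW ?rho_gt0.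
  have -> : X n.+1 w s = n.+1%:R * (`|f w s ^+ n * fw w s| / rho s).
    rewrite /X /dX /= -2!mulrA normrM ger0_norm // mulrA normrM.
    by rewrite (ger0_norm rV).
  by rewrite ler_wpM2l // -mulrDl ler_wpM2r.
rewrite iintZ //; last 2 first.
- exact: measurable_funD.
- by move=> w s Sz; rewrite addr_ge0 ?(sq_ge0 _ _ _ Sz).
rewrite iintD //; [|by move=> w s; exact: sq_ge0|by move=> w s; exact: sq_ge0].
rewrite EFinM; apply: lee_wpmul2l; first by rewrite lee_fin.
by rewrite EFinD; apply: leeD; [exact: fc|].
Qed.

Let iint_Y (c : R) n : (iint R0 theta0 (fun w s => (f w s ^+ n) ^+ 2 / rho s)%R <= c%:E)%E ->
  (iint R0 theta0 (Y n.+1) <= (n.+1%:R * (c + 1))%R%:E)%E.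
Proof.
move=> fc.
have h1 w s : S (w, s) -> 0 <= (f w s ^+ n) ^+ 2 / rho s.
  by case=> /= _ s0; rewrite divr_ge0 ?sqr_ge0 ?ltW ?rho_gt0.
have h2 w s : S (w, s) -> 0 <= fs w s ^+ 2 * rho s.
  by case=> /= _ s0; rewrite mulr_ge0 ?sqr_ge0 ?ltW ?rho_gt0.
have m1 : msector R0 theta0 (fun w s => (f w s ^+ n) ^+ 2 / rho s).
  by apply: contS_msector; apply: contM => //; do 2 apply: contX.
have m2 : msector R0 theta0 (fun w s => fs w s ^+ 2 * rho s).
  by apply: contS_msector; apply: contM => //; apply: contX.
apply: (@le_trans _ _ (iint R0 theta0 (fun w s => n.+1%:R *
  ((f w s ^+ n) ^+ 2 / rho s + fs w s ^+ 2 * rho s)))).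
  apply: le_iint.
  - by apply: contS_msector; exact: cont_Y.
  - by apply: measurable_funM => //; exact: measurable_funD.
  move=> w s [/= _ s0]; rewrite normr_ge0 /=.
  have -> : Y n.+1 w s = n.+1%:R * `|f w s ^+ n * fs w s|.
    by rewrite /Y /dY /= mulr1 -mulrA normrM ger0_norm.
  rewrite ler_wpM2l //.
  have r0 := rho_gt0 s0; have sr0 : 0 < Num.sqrt (rho s) by rewrite sqrtr_gt0.
  (* No weight is present here: it is created by splitting [1] into [1 / sqrt rho] on [f ^+ n] and
     [sqrt rho] on [fs], which yields the two weights of the hypotheses. *)
  have := normr_mul_le (f w s ^+ n / Num.sqrt (rho s)) (fs w s * Num.sqrt (rho s)).
  rewrite mulrACA mulVf ?gt_eqF // mulr1 => /le_trans; apply.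
  by rewrite exprMn exprVn exprMn sqr_sqrtr // ltW.
rewrite iintZ //; last 2 first.
- exact: measurable_funD.
- by move=> w s Sz; rewrite addr_ge0 ?h1 ?h2.
rewrite iintD //.
rewrite EFinM; apply: lee_wpmul2l; first by rewrite lee_fin.
by rewrite EFinD; apply: leeD; [exact: fc|].
Qed.

Let pow_le_X n w s : S (w, s) ->
  (`|f w s ^+ n.+1 / rho s|%:E <=
    \int[lebesgue_measure]_(x in `]0%R, theta0[) (X n.+1 x s)%:E)%E.
Proof.
move=> [/= /andP[w0 wt] s0].
have Sx x : x \in `]0, theta0[ -> S (x, s) by rewrite in_itv.
apply: (@normr_le_integral_derive _ (fun x => f x s ^+ n.+1 / rho s)
  (fun x => dX n.+1 x s) _ 0) => //.
- by move=> y /andP[y0 yw]; rewrite in_itv /= y0 (le_lt_trans yw).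
- by move=> y /Sx/f_C1[/= fy _ _ _ _]; exact: is_derive_exprMr.
- by move=> y /Sx Sy; apply: (continuous_slice1 (h := dX n.+1)); exact: cont_dX Sy.
- by apply: cvg_exprM0; exact: (proj1 f0).
Qed.

Let pow_le_Y n w s : S (w, s) ->
  (`|f w s ^+ n.+1|%:E <=
    \int[lebesgue_measure]_(x in `]R0, +oo[) (Y n.+1 w x)%:E)%E.
Proof.
move=> [/= w0 s0].
have Sx x : x \in `]R0, +oo[ -> S (w, x) by rewrite in_itv /= andbT.
rewrite -[f w s ^+ _]mulr1.
apply: (@normr_le_integral_derive _ (fun x => f w x ^+ n.+1 * 1)
  (dY n.+1 w) _ R0) => //.
- by move=> y /andP[y0 yw]; rewrite in_itv /= y0.
- by move=> y /Sx/f_C1[/= _ fy _ _ _]; exact: is_derive_exprMr.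
- by move=> y /Sx Sy; apply: (continuous_slice2 (h := dY n.+1)); exact: cont_dY Sy.
- by apply: cvg_exprM0; exact: (proj2 f0).
Qed.

(** Induction on [k]: [X k.+2] and [Y k.+2] contain [f] to the power [k.+1], whose weighted square
    is what the induction hypothesis controls. *)
Lemma even_moment_le k :
  (iint R0 theta0 (fun w s => (f w s ^+ k.+1) ^+ 2 / rho s)%R <=
   (moment_bound R k)%:E)%E.
Proof.
elim: k => [|k IHk]; first exact: f_le1.
have X0 n w s : 0 <= X n w s by exact: normr_ge0.
have Y0 n w s : 0 <= Y n w s by exact: normr_ge0.
apply: (@le_trans _ _ (iint R0 theta0 (X k.+2) * iint R0 theta0 (Y k.+2))%E).
  apply: iint_le_mul.
  - by apply: contS_msector; apply: contM => //; do 2 apply: contX.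
  - by apply: contS_msector; exact: cont_X.
  - by apply: contS_msector; exact: cont_Y.
  - by move=> w s [/= _ s0]; rewrite divr_ge0 ?sqr_ge0 ?ltW ?rho_gt0.
  - by move=> *; exact: X0.
  - by move=> *; exact: Y0.
  move=> w s Sz.
  (* The weight [1 / rho] sits in the first bound only, so the product of the two left-hand sides is
     exactly [(f ^+ k.+2) ^+ 2 / rho]. *)
  apply: le_trans (lee_pmul _ _ (pow_le_X k.+1 Sz) (pow_le_Y k.+1 Sz)).
  - rewrite -EFinM -normrM lee_fin (le_trans _ (ler_norm _)) //.
    by rewrite [leRHS]mulrAC -expr2.
  - by rewrite lee_fin.
  - by rewrite lee_fin.
rewrite [moment_bound _ _]/= expr2 EFinM; apply: lee_pmul.
- by apply: iint_ge0.
- by apply: iint_ge0.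
- exact: iint_X.
- exact: iint_Y.
Qed.

Lemma moment_le (p : R) k : 2 <= p <= (k.+1.*2)%:R ->
  (iint R0 theta0 (fun w s => `|f w s| `^ p / rho s)%R <=
   (1 + moment_bound R k)%R%:E)%E.
Proof.
move=> pk.
have m_f : msector R0 theta0 f by exact: contS_msector.
have m_rV : msector R0 theta0 (fun _ s => (rho s)^-1) by exact: contS_msector.
have m1 : msector R0 theta0 (fun w s => f w s ^+ 2 / rho s).
  by apply: contS_msector; apply: contM => //; exact: contX.
have m2 : msector R0 theta0 (fun w s => (f w s ^+ k.+1) ^+ 2 / rho s).
  by apply: contS_msector; apply: contM => //; do 2 apply: contX.
have rV s : R0 < s -> 0 <= (rho s)^-1 by move=> s0; rewrite invr_ge0 ltW ?rho_gt0.
apply: (@le_trans _ _ (iint R0 theta0 (fun w s =>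
    f w s ^+ 2 / rho s + (f w s ^+ k.+1) ^+ 2 / rho s))).
  apply: le_iint.
  - apply: measurable_funM => //.
    apply: (measurableT_comp (measurable_powR p)).
    exact: (measurableT_comp (@normr_measurable R setT)).
  - exact: measurable_funD.
  move=> w s [/= _ s0]; rewrite mulr_ge0 ?powR_ge0 ?rV //=.
  by rewrite -mulrDl ler_wpM2r ?rV // powR_le_sqr_expr.
rewrite iintD //; last 2 first.
- by move=> w s [/= _ s0]; rewrite mulr_ge0 ?sqr_ge0 ?rV.
- by move=> w s [/= _ s0]; rewrite mulr_ge0 ?sqr_ge0 ?rV.
by rewrite EFinD; apply: leeD; [exact: f_le1|exact: even_moment_le].
Qed.

End moments.

(** * The energy density of [normB] and the rescaled function *)

(** Integrand of the squared norm, with the derivative of [r v] expanded by the product rule and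
    [r' = sqrt eps]. *)
Definition energy (R : realType) (R0 delta eps : R) (v : R -> R -> R) (w s : R) :=
  polar_radius R0 eps s `^ delta *
    (Num.sqrt eps * v w s + polar_radius R0 eps s * ds v w s) ^+ 2
  + eps * dw v w s ^+ 2 * polar_radius R0 eps s `^ delta
  + eps * v w s ^+ 2 * polar_radius R0 eps s `^ delta.

Lemma energy_ge0 (R : realType) (R0 delta eps : R) (v : R -> R -> R) (w s : R) :
  0 <= eps -> 0 <= energy R0 delta eps v w s.
Proof.
move=> eps0; apply: addr_ge0; first apply: addr_ge0.
- exact: mulr_ge0 (powR_ge0 _ _) (sqr_ge0 _).
- exact: mulr_ge0 (mulr_ge0 eps0 (sqr_ge0 _)) (powR_ge0 _ _).
- exact: mulr_ge0 (mulr_ge0 eps0 (sqr_ge0 _)) (powR_ge0 _ _).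
Qed.

Lemma normB_energy (R : realType) (R0 theta0 delta eps : R) (v : R -> R -> R) :
  C1_on (sector R0 theta0) v ->
  normB R0 theta0 eps delta v =
  (iint R0 theta0 (energy R0 delta eps v) `^ 2^-1)%E.
Proof.
move=> v_C1; rewrite /normB (eq_iint (Y := energy R0 delta eps v)) // => w s Sz.
have [_ vs _ _ _] := C1_onP (@open_sector _ _ _) v_C1 Sz.
have H := is_deriveM (is_derive_affine R0 (Num.sqrt eps) R0 s) vs.
rewrite /energy real_normK ?num_real //; congr (_ * _ ^+ 2 + _ + _).
rewrite {1}/ds derive1E (@derive_val _ _ _ _ _ _ _ H).
by rewrite addrC /GRing.scale /= (mulrC (v w s)).
Qed.

(* [sg] is chosen so that [energy <= t ^ 2] bounds by 1 the three integrals
   required by [moment_le] for [f] and the weight [r]. *)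
Section rescaling.
Context (R : realType) (R0 theta0 p delta eps t : R) (k : nat) (v : R -> R -> R).
Let S := sector R0 theta0.
Hypothesis R0_gt0 : 0 < R0.
Hypothesis p_bnd : 2 <= p <= (k.+1.*2)%:R.
Hypothesis delta01 : 0 <= delta <= 1.
Hypothesis eps01 : 0 < eps <= 1.
Hypothesis t_gt0 : 0 < t.
Hypothesis v_C1 : C1_on S v.
Hypothesis v0 : no_slip R0 theta0 v.

Let r := polar_radius R0 eps.
Let se := Num.sqrt eps.
Let sg := Num.sqrt 2 * t / se.
(** Since [2 a - 1 = delta], the weight of [f ^+ 2 / r] is a multiple of [r^delta]. The factor [q]
    gives [r^a = q r] and [r^delta = q^2 r], which leaves only rational identities for [field]. *)
Let a := (1 + delta) / 2.
Let q s := r s `^ (a - 1).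
Let m s := r s `^ a / sg.
Let dm s := a * q s * se / sg.
Let f w s := v w s * m s.
Let fw w s := dw v w s * m s.
Let fs w s := v w s * dm s + m s * ds v w s.
(** Convertible to [energy R0 delta eps v], written with the local names used in the algebra
    below. *)
Let B w s := r s `^ delta * (se * v w s + r s * ds v w s) ^+ 2
  + eps * dw v w s ^+ 2 * r s `^ delta + eps * v w s ^+ 2 * r s `^ delta.

Hypothesis energy_le : (iint R0 theta0 (energy R0 delta eps v) <= (t ^+ 2)%:E)%E.

Let eps_gt0 : 0 < eps. Proof. by case/andP: eps01. Qed.
Let se_gt0 : 0 < se. Proof. by rewrite sqrtr_gt0. Qed.
Let se2 : se ^+ 2 = eps. Proof. by rewrite sqr_sqrtr // ltW. Qed.
Let sg_gt0 : 0 < sg. Proof. by rewrite divr_gt0 // mulr_gt0 // sqrtr_gt0. Qed.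
Let sg2 : sg ^+ 2 = 2 * t ^+ 2 / eps.
Proof. by rewrite /sg expr_div_n exprMn sqr_sqrtr // se2. Qed.

Let r_gt0 s : R0 <= s -> 0 < r s.
Proof.
by move=> s0; rewrite ltr_wpDr // mulr_ge0 ?subr_ge0 // ltW.
Qed.

Let powa s : R0 < s -> r s `^ a = q s * r s.
Proof.
move=> s0; have r0 := r_gt0 (ltW s0); have rn0 : r s != 0 by rewrite gt_eqF.
rewrite /q -[X in _ * X]powRr1 ?ltW //.
by rewrite -powRD ?subrK // rn0 implybT.
Qed.

Let powdelta s : R0 < s -> r s `^ delta = q s ^+ 2 * r s.
Proof.
move=> s0; have r0 := r_gt0 (ltW s0); have rn0 : r s != 0 by rewrite gt_eqF.
rewrite /q -powR_mulrn ?powR_ge0 // -powRrM -[X in _ * X]powRr1 ?ltW //.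
rewrite -powRD ?rn0 ?implybT //; by congr (_ `^ _); rewrite /a; field.
Qed.

Let der_r (s : R) : is_derive s 1 r se.
Proof. exact: is_derive_affine. Qed.

Let der_pow (b s : R) : R0 <= s -> is_derive s 1 (fun x => r x `^ b) (b * r s `^ (b - 1) * se).
Proof.
move=> s0; apply: (is_derive1_comp (f := fun x => x `^ b) (g := r)) => //.
exact: is_derive1_powR (r_gt0 s0).
Qed.

Let cont_pow (b s : R) : R0 <= s -> {for s, continuous (fun x => r x `^ b)}.
Proof. by move=> /(der_pow b); exact: is_derive_continuous. Qed.

Let der_m (s : R) : R0 <= s -> is_derive s 1 m (dm s).
Proof.
move=> s0; have := is_derive_exprMr 1 sg^-1 (der_pow a s0).
by rewrite expr0 mulr1 mul1r.
Qed.

Let cont_m (s : R) : R0 <= s -> {for s, continuous m}.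
Proof. by move=> /der_m; exact: is_derive_continuous. Qed.

Let cont_dm (s : R) : R0 <= s -> {for s, continuous dm}.
Proof.
move=> s0; apply: cvgM; last exact: cvg_cst.
apply: cvgM; last exact: cvg_cst.
by apply: cvgM; [exact: cvg_cst|exact: cont_pow].
Qed.

Let v_isC1 : is_C1_on S v (dw v) (ds v).
Proof. by apply: C1_onP v_C1; exact: open_sector. Qed.

Let f_C1 : is_C1_on S f fw fs.
Proof.
move=> z Sz; have [vw vs cv cvw cvs] := v_isC1 Sz.
have s0 : R0 <= z.2 by case: Sz => _ /ltW.
have cm := continuous_comp_snd (cont_m s0).
have cdm := continuous_comp_snd (cont_dm s0).
split.
- have := is_derive_exprMr 1 (m z.2) vw.
  by rewrite expr0 mulr1 mul1r.
- exact: is_deriveM vs (der_m s0).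
- exact: cvgM cv cm.
- exact: cvgM cvw cm.
- by apply: cvgD; [exact: cvgM cv cdm|exact: cvgM cm cvs].
Qed.

(** On the side [R = R0] the multiplier [m] must have a finite limit; it is continuous there because
    [r R0 = R0 > 0]. *)
Let f_no_slip : no_slip R0 theta0 f.
Proof.
have [v01 v02] := v0; split=> [s s0|w w0].
- by rewrite -[X in _ --> X](mul0r (m s)); apply: cvgM; [exact: v01|exact: cvg_cst].
- rewrite -[X in _ --> X](mul0r (m R0)); apply: cvgM; first exact: v02.
  by apply: cvg_at_right_filter; exact: cont_m.
Qed.

Let meas_v : msector R0 theta0 v.
Proof.
apply: open_continuous_measurable_prod; first exact: open_sector.
by move=> z Sz; have [_ _ c _ _] := v_isC1 Sz; exact: c.
Qed.

Let meas_dwv : msector R0 theta0 (dw v).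
Proof.
apply: open_continuous_measurable_prod; first exact: open_sector.
by move=> z Sz; have [_ _ _ c _] := v_isC1 Sz; exact: c.
Qed.

Let meas_dsv : msector R0 theta0 (ds v).
Proof.
apply: open_continuous_measurable_prod; first exact: open_sector.
by move=> z Sz; have [_ _ _ _ c] := v_isC1 Sz; exact: c.
Qed.

Let meas_s (g : R -> R) : (forall s, R0 <= s -> {for s, continuous g}) ->
  msector R0 theta0 (fun _ s => g s).
Proof.
move=> cg; apply: open_continuous_measurable_prod; first exact: open_sector.
by move=> z [_ /ltW s0]; apply: continuous_comp_snd; exact: cg.
Qed.

Let cont_r (s : R) : R0 <= s -> {for s, continuous r}.
Proof. by move=> _; exact: is_derive_continuous (der_r s). Qed.

Let cont_rV (s : R) : R0 <= s -> {for s, continuous (fun x => (r x)^-1)}.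
Proof. by move=> s0; apply: cvgV; [rewrite gt_eqF ?r_gt0|exact: cont_r]. Qed.

Let meas_r := meas_s cont_r.
Let meas_rV := meas_s cont_rV.
Let meas_m := meas_s cont_m.
Let meas_dm := meas_s cont_dm.
Let meas_rd := meas_s (@cont_pow delta).

Let meas_B : msector R0 theta0 B.
Proof.
apply: measurable_funD; first apply: measurable_funD.
- apply: measurable_funM => //; apply: measurable_funX.
  by apply: measurable_funD; apply: measurable_funM.
- by apply: measurable_funM => //; apply: measurable_funM => //; exact: measurable_funX.
- by apply: measurable_funM => //; apply: measurable_funM => //; exact: measurable_funX.
Qed.

Let mulr_pow_ge0 (x s : R) : 0 <= eps * x ^+ 2 * r s `^ delta.
Proof. exact: mulr_ge0 (mulr_ge0 (ltW eps_gt0) (sqr_ge0 _)) (powR_ge0 _ _). Qed.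

Let pow_mulr_ge0 (x s : R) : 0 <= r s `^ delta * x ^+ 2.
Proof. exact: mulr_ge0 (powR_ge0 _ _) (sqr_ge0 _). Qed.

Let B_ge0 w s : 0 <= B w s. Proof. exact: energy_ge0 (ltW eps_gt0). Qed.

Let iint_le1 X : msector R0 theta0 X ->
  (forall w s, S (w, s) -> 0 <= X w s <= (t ^+ 2)^-1 * B w s) ->
  (iint R0 theta0 X <= 1)%E.
Proof.
move=> mX XB; have t2 : 0 < t ^+ 2 by rewrite exprn_gt0.
apply: (@le_trans _ _ (iint R0 theta0 (fun w s => (t ^+ 2)^-1 * B w s))).
  by apply: le_iint => //; exact: measurable_funM.
rewrite iintZ ?invr_ge0 ?(ltW t2) //.
apply: (@le_trans _ _ ((t ^+ 2)^-1%:E * (t ^+ 2)%:E)%E).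
  by apply: lee_wpmul2l => //; rewrite lee_fin invr_ge0 ltW.
by rewrite -EFinM mulVf // gt_eqF.
Qed.

Let f_le1 : (iint R0 theta0 (fun w s => f w s ^+ 2 / r s)%R <= 1)%E.
Proof.
apply: iint_le1.
  by apply: measurable_funM => //; apply: measurable_funX; exact: measurable_funM.
move=> w s [/= _ s0]; have r0 := r_gt0 (ltW s0).
rewrite divr_ge0 ?sqr_ge0 ?(ltW r0) //=.
have -> : f w s ^+ 2 / r s = (t ^+ 2)^-1 * (eps * v w s ^+ 2 * r s `^ delta / 2).
  rewrite powdelta // /f /m powa // !exprMn exprVn sg2; field.
  by rewrite !gt_eqF.
rewrite ler_wpM2l ?invr_ge0 ?sqr_ge0 // /B.
have h1 := pow_mulr_ge0 (se * v w s + r s * ds v w s) s.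
have h2 := mulr_pow_ge0 (dw v w s) s; have h3 := mulr_pow_ge0 (v w s) s.
lra.
Qed.

Let fw_le1 : (iint R0 theta0 (fun w s => fw w s ^+ 2 / r s)%R <= 1)%E.
Proof.
apply: iint_le1.
  by apply: measurable_funM => //; apply: measurable_funX; exact: measurable_funM.
move=> w s [/= _ s0]; have r0 := r_gt0 (ltW s0).
rewrite divr_ge0 ?sqr_ge0 ?(ltW r0) //=.
have -> : fw w s ^+ 2 / r s = (t ^+ 2)^-1 * (eps * dw v w s ^+ 2 * r s `^ delta / 2).
  rewrite powdelta // /fw /m powa // !exprMn exprVn sg2; field.
  by rewrite !gt_eqF.
rewrite ler_wpM2l ?invr_ge0 ?sqr_ge0 // /B.
have h1 := pow_mulr_ge0 (se * v w s + r s * ds v w s) s.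
have h2 := mulr_pow_ge0 (dw v w s) s; have h3 := mulr_pow_ge0 (v w s) s.
lra.
Qed.

(** With [D] the derivative of [r v] and [V = sqrt eps * v], one has [fs = q (D + (a - 1) V) / sg],
    so both the first and the last term of [B] are used. *)
Let fs_le1 : (iint R0 theta0 (fun w s => fs w s ^+ 2 * r s)%R <= 1)%E.
Proof.
apply: iint_le1.
  apply: measurable_funM => //; apply: measurable_funX.
  by apply: measurable_funD; exact: measurable_funM.
move=> w s [/= _ s0]; have r0 := r_gt0 (ltW s0).
rewrite mulr_ge0 ?sqr_ge0 ?(ltW r0) //=.
pose D := se * v w s + r s * ds v w s.
have -> : fs w s ^+ 2 * r s = (t ^+ 2)^-1 *
    (r s `^ delta * (eps * (D + (a - 1) * (se * v w s)) ^+ 2 / 2)).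
  have -> : fs w s = q s * (D + (a - 1) * (se * v w s)) / sg.
    rewrite /fs /dm /m powa // /D; field.
    by rewrite !gt_eqF.
  rewrite powdelta // !exprMn exprVn sg2; field.
  by rewrite !gt_eqF.
rewrite ler_wpM2l ?invr_ge0 ?sqr_ge0 // /B -/D.
have -> : eps * v w s ^+ 2 = (se * v w s) ^+ 2 by rewrite exprMn se2.
have h2 := mulr_pow_ge0 (dw v w s) s.
set V := se * v w s.
(* This follows from [(x + y)^2 <= 2 (x^2 + y^2)], [|a - 1| <= 1] and [eps <= 1]; the factor 2 is
   the one built into [sg]. *)
suff : eps * (D + (a - 1) * V) ^+ 2 / 2 <= D ^+ 2 + V ^+ 2.
  move=> /(ler_wpM2l (powR_ge0 (r s) delta)); lra.
have e1 : eps <= 1 by case/andP: eps01.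
have a1 : (a - 1) ^+ 2 <= 1 by rewrite /a; case/andP: delta01; nra.
have H1 : (D + (a - 1) * V) ^+ 2 <= 2 * (D ^+ 2 + V ^+ 2).
  have := sqr_ge0 (D - (a - 1) * V); have := sqr_ge0 V; nra.
have H2 := ler_wpM2r (sqr_ge0 (D + (a - 1) * V)) e1.
lra.
Qed.

Lemma rescaled_bound :
  ((eps `^ 2^-1)%:E * (iint R0 theta0 (fun w s =>
      `|v w s| `^ p * r s `^ (p / 2 - 1 + delta * p / 2))%R) `^ p^-1 <=
   (Num.sqrt 2 * (1 + moment_bound R k) `^ p^-1 * t)%R%:E)%E.
Proof.
have p_gt0 : 0 < p by case/andP: p_bnd => p2 _; exact: lt_le_trans p2.
have sg0 := ltW sg_gt0.
have M0 : 0 <= 1 + moment_bound R k by rewrite addr_ge0 ?moment_bound_ge0.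
have F0 w s : S (w, s) -> 0 <= `|f w s| `^ p / r s.
  by move=> [/= _ /ltW s0]; rewrite divr_ge0 ?powR_ge0 // ltW ?r_gt0.
(* As [a p = p / 2 + delta p / 2], the integrand is [(|v| r^a)^p / r], and [|v| r^a = sg |f|]. *)
rewrite (eq_iint (Y := fun w s => sg `^ p * (`|f w s| `^ p / r s))); last first.
  move=> w s [/= _ s0]; have r0 := r_gt0 (ltW s0).
  have rn0 : r s != 0 by rewrite gt_eqF.
  have fE : sg * `|f w s| = `|v w s| * r s `^ a.
    rewrite /f /m normrM (ger0_norm (divr_ge0 (powR_ge0 _ _) sg0)); field.
    by rewrite gt_eqF.
  rewrite mulrA -powRM // fE powRM ?powR_ge0 // -[RHS]mulrA.
  congr (_ * _); rewrite -powRrM -[X in _ = _ / X]powRr1 ?ltW //.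
  rewrite -[X in _ = _ * X]powRN -powRD ?rn0 ?implybT //.
  by congr (_ `^ _); rewrite /a; field.
rewrite iintZ ?powR_ge0 //; last first.
  apply: measurable_funM => //; apply: (measurableT_comp (measurable_powR p)).
  by apply: (measurableT_comp (@normr_measurable R setT)); exact: measurable_funM.
have le1 := moment_le (fun s s0 => r_gt0 (ltW s0)) (fun s s0 => cont_r (ltW s0))
  f_C1 f_no_slip f_le1 fw_le1 fs_le1 p_bnd.
apply: (@le_trans _ _ ((eps `^ 2^-1)%:E *
    ((sg `^ p)%:E * (1 + moment_bound R k)%:E) `^ p^-1)%E).
  apply: lee_wpmul2l; first by rewrite lee_fin powR_ge0.
  apply: gt0_ler_poweR.
  - by rewrite invr_ge0 ltW.
  - by rewrite in_itv /= leey andbT mule_ge0 ?lee_fin ?powR_ge0 // iint_ge0.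
  - by rewrite in_itv /= leey andbT mule_ge0 ?lee_fin ?powR_ge0.
  - by apply: lee_wpmul2l => //; rewrite lee_fin powR_ge0.
rewrite -(EFinM (sg `^ p)) poweR_EFin -EFinM lee_fin powRM ?powR_ge0 //.
(* The p-th root turns [sg^p] into [sg], and [sqrt eps * sg = sqrt 2 * t], so [eps] cancels from the
   constant. *)
rewrite -powRrM mulfV ?gt_eqF // powRr1 // (powR12_sqrt (ltW eps_gt0)).
rewrite -/se /sg [leLHS](_ : _ = Num.sqrt 2 * (1 + moment_bound R k) `^ p^-1 * t) //.
by field; rewrite gt_eqF.
Qed.

End rescaling.

(** * The estimate with a constant depending on [p] only *)

Unset Implicit Arguments.
Set Strict Implicit.

Theorem lemma2p9 (R : realType) (R0 theta0 : R) (hR0 : 0 < R0)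
    (htheta0 : 0 < theta0) (p : R) (hp : 2 <= p) :
  exists C : R, 0 < C /\
    forall (delta eps : R) (u v P : R -> R -> R),
      0 <= delta <= 1 ->
      0 < eps <= 1 ->
      C1_on (sector R0 theta0) u ->
      C1_on (sector R0 theta0) v ->
      boundary_conditions R0 theta0 eps u v P ->
      divergence_free R0 theta0 eps u v ->
      ((eps `^ 2^-1)%R%:E *
         (iint R0 theta0 (fun w s =>
            (`|v w s| `^ p
             * polar_radius R0 eps s `^ (p / 2 - 1 + delta * p / 2))%R)) `^ p^-1
       <= C%:E * normB R0 theta0 eps delta v)%E.
Proof.
(* Then [p < k + 1 <= 2 (k + 1)], so [p] lies below the even exponent [2 (k + 1)]. *)
pose k := Num.trunc p.
have pk : 2 <= p <= (k.+1.*2)%:R.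
  rewrite hp (le_trans (ltW (truncnS_gt p))) // ler_nat -addnn.
  exact: leq_addr.
pose C := Num.sqrt 2 * (1 + moment_bound R k) `^ p^-1.
have C0 : 0 < C.
  rewrite mulr_gt0 ?sqrtr_gt0 // powR_gt0 //.
  by rewrite ltr_wpDr ?moment_bound_ge0.
exists C; split => // delta eps u v P hdelta heps _ hv [_ v0 _ _] _.
rewrite normB_energy //; set I := iint _ _ (energy _ _ _ _).
have I0 : (0 <= I)%E.
  by apply: iint_ge0 => w s _; apply: energy_ge0; case/andP: heps => /ltW.
have bound (t : R) : 0 < t -> (I <= (t ^+ 2)%:E)%E -> _ :=
  fun t0 It => rescaled_bound hR0 pk hdelta heps t0 hv v0 It.
(* If the energy is infinite, the right-hand side is [+oo] because [C > 0]. *)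
case EI : I I0 bound => [b| |] //; last first.
  move=> _ _; rewrite poweRyr ?invr_eq0 // gt0_muley ?lte_fin //.
  exact: leey.
rewrite lee_fin => b0 bound; rewrite poweR_EFin (powR12_sqrt b0).
(* [b] may vanish, while [rescaled_bound] needs [t > 0]. *)
apply/lee_addgt0Pr => e e0.
(* Taking [t = sqrt b + e / C] makes the excess [C * (e / C)] equal to [e]. *)
have eC : 0 < e / C by rewrite divr_gt0.
have t0 : 0 < Num.sqrt b + e / C by rewrite ltr_wpDl ?sqrtr_ge0.
have bt : (b%:E <= ((Num.sqrt b + e / C) ^+ 2)%:E)%E.
  rewrite lee_fin -{1}(sqr_sqrtr b0) lerXn2r ?nnegrE ?sqrtr_ge0 //.
    exact: ltW.
  by rewrite lerDl ltW.
apply: (le_trans (bound _ t0 bt)).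
rewrite -EFinM -EFinD lee_fin -/C mulrDr lerD2l.
by rewrite mulrCA mulfV ?mulr1 // gt_eqF.
Qed.
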